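(* Let $(\mathcal V_0,g)$ be the static and spherically symmetric spacetime resulting from the matching of $(\mathcal V_0^+,g^+)$ (interior) and $(\mathcal V_0^-,g^-)$ (exterior), with $$g^\pm=-e^{\nu_\pm(r_\pm)}dt_\pm^2+e^{\lambda_\pm(r_\pm)}dr_\pm^2+r_\pm^2(d\theta_\pm^2+\sin^2\theta_\pm\, d\varphi_\pm^2),$$ across $\Sigma_0^\pm=\{t_\pm=\tau,\ r_\pm=a,\ \theta_\pm=\vartheta,\ \varphi_\pm=\phi\}$, with $a>0$ constant, so that the background matching conditions $[\nu]=0$, $[\nu']=0$, $[\lambda]=0$ hold, and with unit normals $\vec n^\pm=-e^{-\lambda_\pm(a)/2}\partial_{r_\pm}|_{\Sigma_0^\pm}$. Consider at either side the first order metric perturbation tensor $$K^{(1)\pm}=-2r_\pm^2\,\omega^\pm(r_\pm,\theta_\pm)\sin^2\theta_\pm\, dt_\pm d\varphi_\pm ,$$ plus two unknown functions $Q_1^\pm(\tau,\vartheta)$ and two unknown vectors $\vec T_1^\pm=T_1^{\pm\,\tau}(\tau,\vartheta)\partial_\tau+T_1^{\pm\,\vartheta}(\tau,\vartheta)\partial_\vartheta+T_1^{\pm\,\phi}(\tau,\vartheta)\partial_\phi$ on $\Sigma_0$. The necessary and sufficient conditions that $K^{(1)\pm}$ must satisfy to fulfil the first order matching conditions are $$[\omega]=b_1,\qquad [\omega']=0,$$ where $b_1$ is an arbitrary constant. Regarding the perturbed matching hypersurface, if $$2e^{\lambda(a)}-2+a\nu'(a)\neq0,$$ the remaining first order matching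 conditions read $$[\vec T_1]=b_1\tau\,\partial_\phi,\qquad [Q_1]=0,\qquad Q_1[\lambda']=0,\qquad Q_1[\nu'']=0.$$
   Context: Conventions. A prime denotes differentiation with respect to the corresponding radial coordinate $r_\pm$. For objects $f^\pm$ defined at either side, $[f]:=f^+|_{\Sigma_0^+}-f^-|_{\Sigma_0^-}$, the points of $\Sigma_0^+$ and $\Sigma_0^-$ being identified through the common parametrization $(\tau,\vartheta,\phi)$ of the abstract manifold $\Sigma_0\equiv\Sigma_0^+=\Sigma_0^-$; if $[f]=0$ the common value is denoted without $\pm$ (e.g. $\lambda(a)$, $\nu'(a)$, $Q_1$). The interior is the side $r_+\le a$, the exterior the side $r_-\ge a$. All functions are assumed sufficiently differentiable up to the boundary. First order matching conditions. At each side (dropping $\pm$) let $g_\varepsilon=g+\varepsilon K^{(1)}+O(\varepsilon^2)$ (extended across $\Sigma_0$), and let $\Phi_\varepsilon:\Sigma_0\to\mathcal V_0$ be a family of embeddings with $\Phi_0$ the background embedding and $\partial_\varepsilon\Phi_\varepsilon|_{\varepsilon=0}=\vec Z_1=Q_1\vec n+\vec T_1$, with $\vec T_1$ tangent to $\Sigma_0$. Let $h_\varepsilon=\Phi_\varepsilon^*g_\varepsilon$, and let $\kappa_\varepsilon$ be the pullback to $\Sigma_0$ of the second fundamental form ($\kappa_{ij}=e_i^\alpha e_j^\beta\nabla_\alpha n_\beta$) of $\Phi_\varepsilon(\Sigma_0)$ with respect to $g_\varepsilon$ and to the $g_\varepsilon$-unit normal that reduces to $\vec n$ at $\varepsilon=0$.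 Put $h^{(1)}=\partial_\varepsilon h_\varepsilon|_{\varepsilon=0}$, $\kappa^{(1)}=\partial_\varepsilon\kappa_\varepsilon|_{\varepsilon=0}$. Explicitly, writing $h,\kappa$ for the background fundamental forms, $D$ for the Levi-Civita connection of $(\Sigma_0,h)$, $e_i^\alpha$ for the tangent basis, $R_{\alpha\mu\beta\nu}$ for the Riemann tensor of $g$, and $Y=K^{(1)}_{\alpha\beta}n^\alpha n^\beta$, $$h^{(1)}_{ij}=\mathcal L_{\vec T_1}h_{ij}+2Q_1\kappa_{ij}+K^{(1)}_{\alpha\beta}e_i^\alpha e_j^\beta,$$ $$\kappa^{(1)}_{ij}=\mathcal L_{\vec T_1}\kappa_{ij}-D_iD_jQ_1+Q_1\left(-n^\mu n^\nu R_{\alpha\mu\beta\nu}e_i^\alpha e_j^\beta+\kappa_{il}\kappa^l{}_j\right)+\tfrac12Y\kappa_{ij}-n_\mu S^{(1)\mu}{}_{\alpha\beta}e_i^\alpha e_j^\beta,$$ with $S^{(1)\alpha}{}_{\beta\gamma}=\frac12\left(\nabla_\beta K^{(1)\alpha}{}_\gamma+\nabla_\gamma K^{(1)\alpha}{}_\beta-\nabla^\alpha K^{(1)}_{\beta\gamma}\right)$. The first order matching conditions are $h^{(1)+}=h^{(1)-}$ and $\kappa^{(1)+}=\kappa^{(1)-}$ on $\Sigma_0$. The tensors $K^{(1)\pm}$ are said to fulfil them if there exist $Q_1^\pm,\vec T_1^\pm$ (depending on $(\tau,\vartheta)$ only, as stated) for which these equalities hold.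
   Formalization: [T_1] equals b_1 τ ∂_φ only up to constant multiples of ∂_τ and ∂_φ (Killing vectors), and the data at a (all with ν'(a)=0) for which a translation-like displacement with [Q_1]≠0 solves the conditions, e.g. the Einstein static universe at both sides, are excluded. *)

(* Defs.v *)
From Stdlib Require Import Reals List Lra.
From Coquelicot Require Import Coquelicot.
Import ListNotations.
Open Scope R_scope.

(** A chart with coordinate labels [I] has points [I -> R]; tensor fields are
    given by their components, contravariant indices being listed first. *)

Class Coords (I : Type) := {
  coords : list I;
  coord_eq_dec : forall i j : I, {i = j} + {i <> j}
}.

Section Chart.
Context {I : Type} {CI : Coords I}.

Definition point := I -> R.

Definition Sum (f : I -> R) : R := fold_right Rplus 0 (map f coords).

Definition kron (i j : I) : R := if coord_eq_dec i j then 1 else 0.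

Definition upd (x : point) (i : I) (s : R) : point :=
  fun j => if coord_eq_dec i j then s else x j.

Definition pd (i : I) (f : point -> R) (x : point) : R :=
  Derive (fun s => f (upd x i s)) (x i).

Variable g : point -> I -> I -> R.

(* Only diagonal metrics occur below; see [spacetime_metric_inv] and
   [hypersurface_metric_inv]. *)
Definition inv_metric (x : point) (i j : I) : R :=
  if coord_eq_dec i j then / g x i i else 0.

(* [christoffel x k i j] is Gamma^k_{ij}. *)
Definition christoffel (x : point) (k i j : I) : R :=
  Sum (fun l => / 2 * inv_metric x k l *
    (pd i (fun y => g y l j) x + pd j (fun y => g y l i) x
     - pd l (fun y => g y i j) x)).

(* [riemann_up x s m b v] is R^s_{m b v}, with
   R^s_{m b v} = d_b Gamma^s_{v m} - d_v Gamma^s_{b m} + ... ; this is the sign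
   for which round spheres have positive sectional curvature. *)
Definition riemann_up (x : point) (s m b v : I) : R :=
  pd b (fun y => christoffel y s v m) x - pd v (fun y => christoffel y s b m) x
  + Sum (fun l => christoffel x s b l * christoffel x l v m
                  - christoffel x s v l * christoffel x l b m).

Definition riemann (x : point) (al m b v : I) : R :=
  Sum (fun s => g x al s * riemann_up x s m b v).

(* [nabla2 K x m a b] is nabla_m K_{ab}. *)
Definition nabla2 (K : point -> I -> I -> R) (x : point) (m a b : I) : R :=
  pd m (fun y => K y a b) x
  - Sum (fun l => christoffel x l m a * K x l b)
  - Sum (fun l => christoffel x l m b * K x a l).

(* [S1 K x al b c] is S^al_{bc}: the raising of the index commutes with nabla. *)
Definition S1 (K : point -> I -> I -> R) (x : point) (al b c : I) : R :=
  Sum (fun s => inv_metric x al s *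
    (/ 2 * (nabla2 K x b s c + nabla2 K x c s b - nabla2 K x s b c))).

Definition hessian (f : point -> R) (x : point) (i j : I) : R :=
  pd i (pd j f) x - Sum (fun k => christoffel x k i j * pd k f x).

Definition lie2 (T : point -> I -> R) (A : point -> I -> I -> R)
    (x : point) (i j : I) : R :=
  Sum (fun k => T x k * pd k (fun y => A y i j) x)
  + Sum (fun k => A x k j * pd i (fun y => T y k) x)
  + Sum (fun k => A x i k * pd j (fun y => T y k) x).

End Chart.

Inductive scoord := s_t | s_r | s_theta | s_phi.
Inductive hcoord := h_tau | h_theta | h_phi.

#[export] Instance scoord_Coords : Coords scoord.
Proof.
  refine {| coords := [s_t; s_r; s_theta; s_phi] |}; decide equality.
Defined.

#[export] Instance hcoord_Coords : Coords hcoord.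
Proof.
  refine {| coords := [h_tau; h_theta; h_phi] |}; decide equality.
Defined.

(* The functions nu(r), lambda(r), omega(r, theta) at one side.  They are taken
   to be extended across r = a, so that ordinary derivatives at r = a are the
   one-sided ones. *)
Record Side := {
  nu : R -> R;
  lam : R -> R;
  omega : R -> R -> R
}.

(* Q_1(tau, theta) and the components of T_1 as functions of (tau, theta). *)
Record Displacement := {
  Q1 : R -> R -> R;
  T1 : hcoord -> R -> R -> R
}.

Definition metric (S : Side) (x : scoord -> R) (al be : scoord) : R :=
  match al, be with
  | s_t, s_t => - exp (nu S (x s_r))
  | s_r, s_r => exp (lam S (x s_r))
  | s_theta, s_theta => x s_r ^ 2
  | s_phi, s_phi => x s_r ^ 2 * sin (x s_theta) ^ 2
  | _, _ => 0
  end.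

(* dt dphi is the symmetrised product, whence K_{t phi} = - r^2 omega sin^2. *)
Definition K1 (S : Side) (x : scoord -> R) (al be : scoord) : R :=
  match al, be with
  | s_t, s_phi | s_phi, s_t =>
      - x s_r ^ 2 * omega S (x s_r) (x s_theta) * sin (x s_theta) ^ 2
  | _, _ => 0
  end.

Section Hypersurface.
Variables (a : R) (S : Side).

Definition embed (p : hcoord -> R) : scoord -> R := fun al =>
  match al with
  | s_t => p h_tau
  | s_r => a
  | s_theta => p h_theta
  | s_phi => p h_phi
  end.

(* [tangent p i al] is e_i^al. *)
Definition tangent (p : hcoord -> R) (i : hcoord) (al : scoord) : R :=
  pd i (fun q => embed q al) p.

Definition normal (p : hcoord -> R) (al : scoord) : R :=
  match al with s_r => - exp (- lam S a / 2) | _ => 0 end.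

Definition conormal (p : hcoord -> R) (be : scoord) : R :=
  Sum (fun al => metric S (embed p) al be * normal p al).

Definition pullback2 (A : scoord -> scoord -> R) (p : hcoord -> R)
    (i j : hcoord) : R :=
  Sum (fun al => Sum (fun be => A al be * tangent p i al * tangent p j be)).

Definition first_form (p : hcoord -> R) (i j : hcoord) : R :=
  pullback2 (metric S (embed p)) p i j.

(* e_i^al e_j^be nabla_al n_be, the derivative of n_be along e_i being taken
   within the hypersurface. *)
Definition second_form (p : hcoord -> R) (i j : hcoord) : R :=
  Sum (fun be => tangent p j be * pd i (fun q => conormal q be) p)
  - pullback2 (fun al be => Sum (fun ga =>
      christoffel (metric S) (embed p) ga al be * conormal p ga)) p i j.

Variable Z : Displacement.

Definition Qfield (p : hcoord -> R) : R := Q1 Z (p h_tau) (p h_theta).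
Definition Tfield (p : hcoord -> R) (k : hcoord) : R :=
  T1 Z k (p h_tau) (p h_theta).

Definition first_form1 (p : hcoord -> R) (i j : hcoord) : R :=
  lie2 Tfield first_form p i j
  + 2 * Qfield p * second_form p i j
  + pullback2 (K1 S (embed p)) p i j.

Definition second_form1 (p : hcoord -> R) (i j : hcoord) : R :=
  lie2 Tfield second_form p i j
  - hessian first_form Qfield p i j
  + Qfield p *
    (- pullback2 (fun al be => Sum (fun m => Sum (fun v =>
         normal p m * normal p v * riemann (metric S) (embed p) al m be v))) p i j
     + Sum (fun l => Sum (fun k =>
         second_form p i l * inv_metric first_form p l k * second_form p k j)))
  + / 2 * Sum (fun al => Sum (fun be =>
       K1 S (embed p) al be * normal p al * normal p be)) * second_form p i j
  - pullback2 (fun al be => Sum (fun m =>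
       conormal p m * S1 (metric S) (K1 S) (embed p) m al be)) p i j.

End Hypersurface.

(* [inv_metric] is the inverse of both metrics away from the axis. *)

Lemma spacetime_metric_inv (S : Side) (x : scoord -> R) (al be : scoord) :
  0 < x s_r -> 0 < x s_theta < PI ->
  Sum (fun ga => metric S x al ga * inv_metric (metric S) x ga be) = kron al be.
Proof.
  intros Hr Hth.
  pose proof (sin_gt_0 _ (proj1 Hth) (proj2 Hth)) as Hs.
  pose proof (exp_pos (nu S (x s_r))).
  pose proof (exp_pos (lam S (x s_r))).
  destruct al, be; unfold Sum, kron, inv_metric; cbn -[pow];
    field; repeat split; lra.
Qed.

Lemma tangent_embed (a : R) (p : hcoord -> R) (i : hcoord) (al : scoord) :
  tangent a p i al =
  match i, al with
  | h_tau, s_t | h_theta, s_theta | h_phi, s_phi => 1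
  | _, _ => 0
  end.
Proof.
  destruct i, al; unfold tangent, pd; cbn;
    first [apply Derive_id | apply Derive_const].
Qed.

Lemma hypersurface_metric_inv (a : R) (S : Side) (p : hcoord -> R)
    (i j : hcoord) :
  0 < a -> 0 < p h_theta < PI ->
  Sum (fun k => first_form a S p i k * inv_metric (first_form a S) p k j)
  = kron i j.
Proof.
  intros Hr Hth.
  pose proof (sin_gt_0 _ (proj1 Hth) (proj2 Hth)) as Hs.
  pose proof (exp_pos (nu S a)).
  destruct i, j; unfold Sum, kron, inv_metric, first_form, pullback2, Sum;
    cbn -[pow tangent]; rewrite ?tangent_embed;
    field; repeat split; nra.
Qed.

Lemma normal_unit (a : R) (S : Side) (p : hcoord -> R) :
  Sum (fun al => conormal a S p al * normal a S p al) = 1.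
Proof.
  unfold conormal, Sum; cbn -[pow].
  transitivity (exp (lam S a) * (exp (- lam S a / 2) * exp (- lam S a / 2)));
    [ring|].
  rewrite <- !exp_plus, <- exp_0; f_equal; lra.
Qed.

Definition C2_near (a : R) (f : R -> R) : Prop :=
  exists d : posreal, forall r, Rabs (r - a) < d ->
  forall k, (k <= 2)%nat -> ex_derive_n f k r /\ continuous (Derive_n f k) r.

Fixpoint Cn_on (n : nat) (U : R -> R -> Prop) (f : R -> R -> R) : Prop :=
  (forall x y, U x y -> continuity_2d_pt f x y) /\
  match n with
  | O => True
  | S m =>
      (forall x y, U x y ->
         ex_derive (fun s => f s y) x /\ ex_derive (fun s => f x s) y) /\
      Cn_on m U (fun x y => Derive (fun s => f s y) x) /\
      Cn_on m U (fun x y => Derive (fun s => f x s) y)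
  end.

Definition regular_side (a : R) (S : Side) : Prop :=
  C2_near a (nu S) /\ C2_near a (lam S) /\
  exists d : posreal,
    Cn_on 2 (fun r th => Rabs (r - a) < d /\ 0 < th < PI) (omega S).

Definition regular_displacement (Z : Displacement) : Prop :=
  Cn_on 2 (fun _ th => 0 < th < PI) (Q1 Z) /\
  forall k, Cn_on 2 (fun _ th => 0 < th < PI) (T1 Z k).

Definition background_matching (a : R) (Sp Sm : Side) : Prop :=
  nu Sp a = nu Sm a /\ Derive (nu Sp) a = Derive (nu Sm) a /\
  lam Sp a = lam Sm a.

Definition first_order_matching (a : R) (Sp Sm : Side) (Zp Zm : Displacement)
    : Prop :=
  forall p : hcoord -> R, 0 < p h_theta < PI -> forall i j : hcoord,
    first_form1 a Sp Zp p i j = first_form1 a Sm Zm p i j /\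
    second_form1 a Sp Zp p i j = second_form1 a Sm Zm p i j.

Definition fulfil_first_order_matching (a : R) (Sp Sm : Side) : Prop :=
  exists Zp Zm : Displacement,
    regular_displacement Zp /\ regular_displacement Zm /\
    first_order_matching a Sp Sm Zp Zm.

(* The 2-jets at r = a for which the displacement
     [T_1] = sin(theta) d_theta,  [Q_1] = a e^{lambda(a)/2} cos(theta)
   solves the matching conditions for suitable Q_1 (with [s] the ratio
   Q_1^- / [Q_1]); for instance the Einstein static universe at both sides,
   whose spheres can be moved by the translations of its spatial sections.
   In particular nu'(a) <> 0 excludes them. *)
Definition translation_degenerate (a : R) (Sp Sm : Side) : Prop :=
  Derive (nu Sp) a = 0 /\
  exists s : R,
    Derive (lam Sp) a + s * (Derive (lam Sp) a - Derive (lam Sm) a)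
      = 2 * (exp (lam Sp a) - 1) / a /\
    Derive_n (nu Sp) 2 a + s * (Derive_n (nu Sp) 2 a - Derive_n (nu Sm) 2 a) = 0.

(* Main.v *)
Require Import Defs.
From Stdlib Require Import Reals Lra Lia FunctionalExtensionality.
From Coquelicot Require Import Coquelicot.
Open Scope R_scope.

(** Write [W], [q], [w] for the jumps of [T_1], [Q_1], [omega], and
    [l = e^{lambda(a)/2}].  The perturbed forms are linear in the displacement,
    so the conditions are equations for these jumps, apart from the terms in
    which [Q_1] multiplies [lambda'] or [nu''].
    The (tau,phi), (theta,phi) components give [d_tau W^phi = w],
    [d_theta W^phi = 0] and [w' = 0]; hence [w] is constant.
    The angular components of [h^(1)] give [W^theta = alpha(tau) sin theta] and
    [q = a l alpha cos theta], and then the (tau,theta) components of [h^(1)] and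
    [kappa^(1)] give [(2 e^lambda - 2 + a nu') alpha' = 0].  So [alpha] is
    constant, [W^tau] does not depend on [theta], and the (tau,tau) component of
    [h^(1)] yields [nu' alpha = 0].  If [alpha <> 0], the diagonal components of
    [kappa^(1)] at [theta = pi/3] are the relations of the degenerate case;
    otherwise [W^theta = q = 0] and these components reduce to
    [Q_1 [lambda'] = Q_1 [nu''] = 0]. *)

(** * Background geometry in closed form *)

Lemma Sum_scoord (f : scoord -> R) :
  Sum f = f s_t + (f s_r + (f s_theta + (f s_phi + 0))).
Proof. reflexivity. Qed.

Lemma Sum_hcoord (f : hcoord -> R) :
  Sum f = f h_tau + (f h_theta + (f h_phi + 0)).
Proof. reflexivity. Qed.

Definition dmetric (S : Side) (x : scoord -> R) (m al be : scoord) : R :=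
  match al, be, m with
  | s_t, s_t, s_r => - (Derive (nu S) (x s_r) * exp (nu S (x s_r)))
  | s_r, s_r, s_r => Derive (lam S) (x s_r) * exp (lam S (x s_r))
  | s_theta, s_theta, s_r => 2 * x s_r
  | s_phi, s_phi, s_r => 2 * x s_r * sin (x s_theta) ^ 2
  | s_phi, s_phi, s_theta =>
      x s_r ^ 2 * (2 * sin (x s_theta) * cos (x s_theta))
  | _, _, _ => 0
  end.

(* [auto_derive] leaves eta-expanded functions under [Derive]. *)
Ltac eta_derive :=
  repeat match goal with
  | |- context [Derive (fun r => ?f r)] =>
      progress change (Derive (fun r => f r)) with (Derive f)
  end.

Lemma pd_metric (S : Side) (x : scoord -> R) (m al be : scoord) :
  ex_derive (nu S) (x s_r) -> ex_derive (lam S) (x s_r) ->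
  pd m (fun y => metric S y al be) x = dmetric S x m al be.
Proof.
intros Hn Hl; unfold pd, metric, dmetric.
destruct al, be; cbn -[pow]; try (destruct m; apply Derive_const);
  destruct m; cbn -[pow]; try apply Derive_const;
  apply is_derive_unique; auto_derive; auto; cbn; eta_derive; ring.
Qed.

Definition spacetime_christoffel (S : Side) (x : scoord -> R) (k i j : scoord) : R :=
  match k, i, j with
  | s_t, s_t, s_r | s_t, s_r, s_t => Derive (nu S) (x s_r) / 2
  | s_r, s_t, s_t =>
      Derive (nu S) (x s_r) * exp (nu S (x s_r)) / (2 * exp (lam S (x s_r)))
  | s_r, s_r, s_r => Derive (lam S) (x s_r) / 2
  | s_r, s_theta, s_theta => - x s_r / exp (lam S (x s_r))
  | s_r, s_phi, s_phi => - x s_r * sin (x s_theta) ^ 2 / exp (lam S (x s_r))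
  | s_theta, s_r, s_theta | s_theta, s_theta, s_r
  | s_phi, s_r, s_phi | s_phi, s_phi, s_r => / x s_r
  | s_theta, s_phi, s_phi => - sin (x s_theta) * cos (x s_theta)
  | s_phi, s_theta, s_phi | s_phi, s_phi, s_theta =>
      cos (x s_theta) / sin (x s_theta)
  | _, _, _ => 0
  end.

(** Only the [s_phi] row divides by [sin (x s_theta)], hence the conditional hypothesis: the radial
    row remains available on the axis, which lets [second_form_eq] hold at every angle. *)
Lemma christoffel_metric (S : Side) (x : scoord -> R) (k i j : scoord) :
  ex_derive (nu S) (x s_r) -> ex_derive (lam S) (x s_r) ->
  0 < x s_r -> (k = s_phi -> sin (x s_theta) <> 0) ->
  christoffel (metric S) x k i j = spacetime_christoffel S x k i j.
Proof.
intros Hn Hl Hr Hs; unfold christoffel; rewrite Sum_scoord, !pd_metric by auto.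
pose proof (exp_pos (nu S (x s_r))) as En.
pose proof (exp_pos (lam S (x s_r))) as El.
destruct k; try specialize (Hs eq_refl);
  destruct i, j; unfold inv_metric, dmetric, spacetime_christoffel, metric; cbn -[pow];
  field; repeat split; lra.
Qed.

Lemma exp_half (x : R) : exp x = exp (x / 2) * exp (x / 2).
Proof. rewrite <- exp_plus; f_equal; lra. Qed.

Lemma exp_opp_half (x : R) : exp (- x / 2) = / exp (x / 2).
Proof. rewrite <- exp_Ropp; f_equal; lra. Qed.

Lemma conormal_eq (a : R) (S : Side) (p : hcoord -> R) (be : scoord) :
  conormal a S p be =
  match be with s_r => - exp (lam S a / 2) | _ => 0 end.
Proof.
unfold conormal; rewrite Sum_scoord; destruct be; cbn -[pow]; try ring.
rewrite exp_opp_half, exp_half; field; apply Rgt_not_eq, exp_pos.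
Qed.

Definition second_form_at (a : R) (S : Side) (p : hcoord -> R) (i j : hcoord) : R :=
  match i, j with
  | h_tau, h_tau => Derive (nu S) a * exp (nu S a) / (2 * exp (lam S a / 2))
  | h_theta, h_theta => - a / exp (lam S a / 2)
  | h_phi, h_phi => - a * sin (p h_theta) ^ 2 / exp (lam S a / 2)
  | _, _ => 0
  end.

Definition lift (i : hcoord) : scoord :=
  match i with h_tau => s_t | h_theta => s_theta | h_phi => s_phi end.

Lemma pullback2_lift (a : R) (A : scoord -> scoord -> R) (p : hcoord -> R)
  (i j : hcoord) : pullback2 a A p i j = A (lift i) (lift j).
Proof.
unfold pullback2; rewrite !Sum_scoord, !tangent_embed.
destruct i, j; cbn; ring.
Qed.

Lemma first_form_eq (a : R) (S : Side) (p : hcoord -> R) (i j : hcoord) :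
  first_form a S p i j =
  match i, j with
  | h_tau, h_tau => - exp (nu S a)
  | h_theta, h_theta => a ^ 2
  | h_phi, h_phi => a ^ 2 * sin (p h_theta) ^ 2
  | _, _ => 0
  end.
Proof.
unfold first_form; rewrite pullback2_lift; destruct i, j; reflexivity.
Qed.

(** The conormal components are constant along the hypersurface, so only [- Gamma^r_{ij} n_r]
    remains. The formula covers all angles because it is later differentiated in theta through
    [Derive_ext]. *)
Lemma second_form_eq (a : R) (S : Side) (p : hcoord -> R) (i j : hcoord) :
  0 < a -> ex_derive (nu S) a -> ex_derive (lam S) a ->
  second_form a S p i j = second_form_at a S p i j.
Proof.
intros Ha Hn Hl; unfold second_form; rewrite pullback2_lift.
assert (Hc : forall be, pd i (fun q => conormal a S q be) p = 0).
{ intros be; unfold pd; erewrite Derive_ext by (intros; apply conormal_eq).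
  apply Derive_const. }
rewrite !Sum_scoord, !Hc, !conormal_eq.
rewrite (christoffel_metric S (embed a p) s_r) by (auto; discriminate).
pose proof (exp_pos (lam S a / 2)) as El.
destruct i, j; cbn [spacetime_christoffel lift embed second_form_at];
  rewrite ?(exp_half (lam S a));
  field; repeat split; try lra.
Qed.

(** The normal is radial, so these are the curvature components that enter [kappa^(1)].
    Differentiability is asked on a neighbourhood because the closed form of the Christoffel symbols
    gets differentiated in r. *)
Lemma riemann_radial (S : Side) (x : scoord -> R) (al be : scoord) :
  0 < x s_r -> sin (x s_theta) <> 0 ->
  locally (x s_r) (fun r => ex_derive (nu S) r /\ ex_derive (lam S) r) ->
  ex_derive (Derive (nu S)) (x s_r) ->
  al <> s_r -> be <> s_r ->
  riemann (metric S) x al s_r be s_r =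
  match al, be with
  | s_t, s_t => exp (nu S (x s_r)) *
      (Derive_n (nu S) 2 (x s_r) / 2 + Derive (nu S) (x s_r) ^ 2 / 4
       - Derive (nu S) (x s_r) * Derive (lam S) (x s_r) / 4)
  | s_theta, s_theta => x s_r * Derive (lam S) (x s_r) / 2
  | s_phi, s_phi =>
      x s_r * Derive (lam S) (x s_r) * sin (x s_theta) ^ 2 / 2
  | _, _ => 0
  end.
Proof.
intros Hr Hs Hloc Hnn Hal Hbe.
destruct (locally_singleton _ _ Hloc) as [Hn Hl].
assert (Hlocr : locally (x s_r) (fun r => 0 < r)).
{ apply (open_gt 0); exact Hr. }
assert (Hrad : forall k i j,
  pd s_r (fun y => christoffel (metric S) y k i j) x
  = Derive (fun r => spacetime_christoffel S (upd x s_r r) k i j) (x s_r)).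
{ intros k i j; unfold pd; apply Derive_ext_loc.
  generalize (filter_and _ _ Hloc Hlocr); apply filter_imp.
  intros r [[? ?] ?]; apply christoffel_metric; auto. }
(* Along theta the moving point can reach the axis, so [christoffel] is unfolded instead of replaced
   by its closed form: the metric derivatives in it vanish whatever value [inv_metric] takes. *)
assert (Htan : forall k, k <> s_r ->
  pd be (fun y => christoffel (metric S) y k s_r s_r) x = 0).
{ intros k Hk; unfold pd; transitivity (Derive (fun _ : R => 0) (x be));
    [|apply Derive_const].
  apply Derive_ext; intros s; unfold christoffel; rewrite Sum_scoord.
  rewrite !pd_metric by (destruct be; cbn; auto; congruence).
  destruct k; try congruence; unfold inv_metric, dmetric; cbn -[pow]; ring. }
assert (Hup : forall k, k <> s_r -> riemann_up (metric S) x k s_r be s_r =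
  - Derive (fun r => spacetime_christoffel S (upd x s_r r) k be s_r) (x s_r)
  + Sum (fun l => spacetime_christoffel S x k be l * spacetime_christoffel S x l s_r s_r
    - spacetime_christoffel S x k s_r l * spacetime_christoffel S x l be s_r)).
{ intros k Hk; unfold riemann_up; rewrite Htan, Hrad by auto.
  rewrite !Sum_scoord, !christoffel_metric by auto; ring. }
assert (HD : forall k, k <> s_r ->
  Derive (fun r => spacetime_christoffel S (upd x s_r r) k be s_r) (x s_r) =
  match k, be with
  | s_t, s_t => Derive_n (nu S) 2 (x s_r) / 2
  | s_theta, s_theta | s_phi, s_phi => - / x s_r ^ 2
  | _, _ => 0
  end).
{ intros k Hk; destruct k, be; try congruence; unfold spacetime_christoffel; cbn -[pow];
    try apply Derive_const; apply is_derive_unique; auto_derive;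
    auto; try lra; eta_derive; field; lra. }
transitivity (metric S x al al * riemann_up (metric S) x al s_r be s_r).
{ unfold riemann; rewrite Sum_scoord.
  destruct al; cbn -[pow riemann_up]; ring. }
rewrite Hup, HD, Sum_scoord by auto.
destruct al, be; try congruence; unfold spacetime_christoffel; cbn -[pow Derive_n];
  field; lra.
Qed.

(** Since [K1] has no radial components, the Christoffel terms of the three covariant derivatives
    cancel, which leaves [S^r_{al be} = - e^{-lambda} d_r K_{al be} / 2]. *)
Lemma S1_radial (S : Side) (x : scoord -> R) (al be : scoord) :
  0 < x s_r -> sin (x s_theta) <> 0 ->
  ex_derive (nu S) (x s_r) -> ex_derive (lam S) (x s_r) ->
  ex_derive (fun r => omega S r (x s_theta)) (x s_r) ->
  al <> s_r -> be <> s_r ->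
  S1 (metric S) (K1 S) x s_r al be =
  match al, be with
  | s_t, s_phi | s_phi, s_t =>
      (2 * x s_r * omega S (x s_r) (x s_theta)
       + x s_r ^ 2 * Derive (fun r => omega S r (x s_theta)) (x s_r))
      * sin (x s_theta) ^ 2 / (2 * exp (lam S (x s_r)))
  | _, _ => 0
  end.
Proof.
intros Hr Hs Hn Hl Hw Hal Hbe.
assert (HK0 : forall m ga, pd m (fun y => K1 S y s_r ga) x = 0).
{ intros m ga; unfold pd; cbn; apply Derive_const. }
assert (HK0' : forall m ga, pd m (fun y => K1 S y ga s_r) x = 0).
{ intros m ga; unfold pd; destruct ga; cbn; apply Derive_const. }
assert (HKr : pd s_r (fun y => K1 S y al be) x =
  match al, be with
  | s_t, s_phi | s_phi, s_t =>
      - (2 * x s_r * omega S (x s_r) (x s_theta)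
       + x s_r ^ 2 * Derive (fun r => omega S r (x s_theta)) (x s_r))
      * sin (x s_theta) ^ 2
  | _, _ => 0
  end).
{ unfold pd, K1; destruct al, be; cbn -[pow]; try apply Derive_const;
    apply is_derive_unique; auto_derive; auto; simpl; ring. }
unfold S1; rewrite Sum_scoord; unfold nabla2.
rewrite !HK0, ?HK0', HKr, !Sum_scoord, !christoffel_metric by auto.
pose proof (exp_pos (lam S (x s_r))) as El.
destruct al, be; try congruence; unfold spacetime_christoffel, K1, inv_metric; cbn -[pow];
  field; repeat split; lra.
Qed.

(** * The perturbed fundamental forms in closed form *)

Lemma pd_first_form (a : R) (S : Side) (p : hcoord -> R) (k i j : hcoord) :
  pd k (fun y => first_form a S y i j) p =
  match k, i, j with
  | h_theta, h_phi, h_phi =>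
      a ^ 2 * (2 * sin (p h_theta) * cos (p h_theta))
  | _, _, _ => 0
  end.
Proof.
unfold pd; erewrite Derive_ext by (intros; apply first_form_eq).
destruct k, i, j; cbn -[pow]; try apply Derive_const.
apply is_derive_unique; auto_derive; auto; simpl; ring.
Qed.

(** Here [u] is tau and [v] is theta; phi drops out by axial symmetry. *)
Definition first_form1_at (a : R) (S : Side) (Z : Displacement) (u v : R)
    (i j : hcoord) : R :=
  match i, j with
  | h_tau, h_tau =>
      - 2 * exp (nu S a) * Derive (fun s => T1 Z h_tau s v) u
      + Q1 Z u v * Derive (nu S) a * exp (nu S a) / exp (lam S a / 2)
  | h_theta, h_theta =>
      2 * a ^ 2 * Derive (fun s => T1 Z h_theta u s) v
      - 2 * a * Q1 Z u v / exp (lam S a / 2)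
  | h_phi, h_phi =>
      2 * a ^ 2 * sin v * cos v * T1 Z h_theta u v
      - 2 * a * sin v ^ 2 * Q1 Z u v / exp (lam S a / 2)
  | h_tau, h_theta | h_theta, h_tau =>
      a ^ 2 * Derive (fun s => T1 Z h_theta s v) u
      - exp (nu S a) * Derive (fun s => T1 Z h_tau u s) v
  | h_tau, h_phi | h_phi, h_tau =>
      a ^ 2 * sin v ^ 2 *
      (Derive (fun s => T1 Z h_phi s v) u - omega S a v)
  | h_theta, h_phi | h_phi, h_theta =>
      a ^ 2 * sin v ^ 2 * Derive (fun s => T1 Z h_phi u s) v
  end.

Lemma first_form1_eq (a : R) (S : Side) (Z : Displacement) (p : hcoord -> R)
    (i j : hcoord) :
  0 < a -> ex_derive (nu S) a -> ex_derive (lam S) a ->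
  first_form1 a S Z p i j = first_form1_at a S Z (p h_tau) (p h_theta) i j.
Proof.
intros Ha Hn Hl; unfold first_form1, lie2.
rewrite pullback2_lift, second_form_eq, !Sum_hcoord, !first_form_eq by auto.
rewrite !pd_first_form.
pose proof (exp_pos (lam S a / 2)) as El.
unfold Tfield, Qfield, pd.
destruct i, j; cbn -[pow]; rewrite ?Derive_const; field; lra.
Qed.

(** The two mixed (tau,theta) entries are kept apart since they differentiate [Q1] in opposite
    orders; no symmetry of second derivatives is invoked. In the (tau,tau) entry, half of the
    coefficient of nu'^2 comes from the curvature and half from the square of [kappa]. *)
Definition second_form1_at (a : R) (S : Side) (Z : Displacement) (u v : R)
    (i j : hcoord) : R :=
  let l := exp (lam S a / 2) in
  match i, j with
  | h_tau, h_tau =>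
      Derive (nu S) a * exp (nu S a) / l * Derive (fun s => T1 Z h_tau s v) u
      - Derive (fun s => Derive (fun w => Q1 Z w v) s) u
      - Q1 Z u v * exp (nu S a) / l ^ 2 *
        (Derive_n (nu S) 2 a / 2 + Derive (nu S) a ^ 2 / 2
         - Derive (nu S) a * Derive (lam S) a / 4)
  | h_theta, h_theta =>
      - 2 * a / l * Derive (fun s => T1 Z h_theta u s) v
      - Derive (fun s => Derive (fun w => Q1 Z u w) s) v
      + Q1 Z u v / l ^ 2 * (1 - a * Derive (lam S) a / 2)
  | h_phi, h_phi =>
      - 2 * a * sin v * cos v / l * T1 Z h_theta u v
      - sin v * cos v * Derive (fun s => Q1 Z u s) v
      + Q1 Z u v * sin v ^ 2 / l ^ 2 * (1 - a * Derive (lam S) a / 2)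
  | h_tau, h_theta =>
      Derive (nu S) a * exp (nu S a) / (2 * l)
        * Derive (fun s => T1 Z h_tau u s) v
      - a / l * Derive (fun s => T1 Z h_theta s v) u
      - Derive (fun s => Derive (fun w => Q1 Z s w) v) u
  | h_theta, h_tau =>
      Derive (nu S) a * exp (nu S a) / (2 * l)
        * Derive (fun s => T1 Z h_tau u s) v
      - a / l * Derive (fun s => T1 Z h_theta s v) u
      - Derive (fun s => Derive (fun w => Q1 Z w s) u) v
  | h_tau, h_phi | h_phi, h_tau =>
      sin v ^ 2 * a / l *
      (omega S a v + a / 2 * Derive (fun r => omega S r v) a
       - Derive (fun s => T1 Z h_phi s v) u)
  | h_theta, h_phi | h_phi, h_theta =>
      - a * sin v ^ 2 / l * Derive (fun s => T1 Z h_phi u s) v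
  end.

Lemma christoffel_first_form (a : R) (S : Side) (p : hcoord -> R)
    (k i j : hcoord) :
  0 < a -> sin (p h_theta) <> 0 ->
  christoffel (first_form a S) p k i j =
  match k, i, j with
  | h_theta, h_phi, h_phi => - sin (p h_theta) * cos (p h_theta)
  | h_phi, h_theta, h_phi | h_phi, h_phi, h_theta =>
      cos (p h_theta) / sin (p h_theta)
  | _, _, _ => 0
  end.
Proof.
intros Ha Hs; unfold christoffel; rewrite Sum_hcoord, !pd_first_form.
unfold inv_metric; rewrite !first_form_eq.
pose proof (exp_pos (nu S a)) as En.
destruct k, i, j; cbn -[pow]; field; repeat split; lra.
Qed.

Lemma second_form1_eq (a : R) (S : Side) (Z : Displacement) (p : hcoord -> R)
    (i j : hcoord) :
  0 < a -> sin (p h_theta) <> 0 ->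
  locally a (fun r => ex_derive (nu S) r /\ ex_derive (lam S) r) ->
  ex_derive (Derive (nu S)) a ->
  ex_derive (fun r => omega S r (p h_theta)) a ->
  second_form1 a S Z p i j = second_form1_at a S Z (p h_tau) (p h_theta) i j.
Proof.
intros Ha Hs Hloc Hnn Hw.
destruct (locally_singleton _ _ Hloc) as [Hn Hl].
assert (Hpd : forall k, pd k (fun y => second_form a S y i j) p =
  match k, i, j with
  | h_theta, h_phi, h_phi =>
      - 2 * a * sin (p h_theta) * cos (p h_theta) / exp (lam S a / 2)
  | _, _, _ => 0
  end).
{ intros k; unfold pd; erewrite Derive_ext
    by (intros; apply second_form_eq; auto).
  pose proof (exp_pos (lam S a / 2)) as El.
  destruct k, i, j; unfold second_form_at; cbn -[pow]; try apply Derive_const.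
  apply is_derive_unique; auto_derive; auto; simpl; field; lra. }
assert (HR : Sum (fun m => Sum (fun v => normal a S p m * normal a S p v
    * riemann (metric S) (embed a p) (lift i) m (lift j) v)) =
  exp (- lam S a / 2) ^ 2
    * riemann (metric S) (embed a p) (lift i) s_r (lift j) s_r).
{ rewrite !Sum_scoord; cbn -[riemann]; ring. }
assert (HS : Sum (fun m => conormal a S p m
    * S1 (metric S) (K1 S) (embed a p) m (lift i) (lift j)) =
  - exp (lam S a / 2) * S1 (metric S) (K1 S) (embed a p) s_r (lift i) (lift j)).
{ rewrite Sum_scoord, !conormal_eq; ring. }
(* [K1] has no (r,r) component, so the Y term disappears. *)
assert (HY : Sum (fun al => Sum (fun be => K1 S (embed a p) al be
    * normal a S p al * normal a S p be)) = 0).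
{ rewrite !Sum_scoord; cbn -[pow]; ring. }
assert (Hlift : forall k, lift k <> s_r) by (intros []; discriminate).
(* [Qfield] does not read the phi coordinate, so the inner derivative is that of a function constant
   up to conversion. *)
assert (HQ : forall k, pd k (pd h_phi (Qfield Z)) p = 0).
{ intros k; transitivity (Derive (fun _ : R => 0) (p k));
    [apply Derive_ext; intros s | apply Derive_const].
  exact (Derive_const (Qfield Z (upd p k s)) _). }
unfold second_form1, lie2, hessian.
rewrite !pullback2_lift, HR, HS, HY, riemann_radial, S1_radial by auto.
rewrite !Sum_hcoord, !second_form_eq, !Hpd, !christoffel_first_form by auto.
unfold inv_metric; rewrite !first_form_eq.
rewrite exp_opp_half; cbn [embed]; rewrite ?(exp_half (lam S a)).
pose proof (exp_pos (lam S a / 2)) as El.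
pose proof (exp_pos (nu S a)) as En.
destruct i, j; rewrite ?HQ; unfold Tfield, Qfield, pd, second_form_at;
  cbn -[pow Derive_n]; rewrite ?Derive_const;
  eta_derive; field; repeat split; lra.
Qed.

(** * Passage to the jumps of the displacement and of [omega] *)

Definition strip (u v : R) : Prop := 0 < v < PI.

Lemma locally_strip (u v : R) : strip u v -> locally v (strip u).
Proof.
intros [H1 H2].
apply (open_and (fun w => 0 < w) (fun w => w < PI));
  [apply open_gt | apply open_lt | split; auto].
Qed.

(* The perturbed forms are linear in the displacement and [omega] jointly, so
   up to [curvature_jump] their jumps are the forms of these two. *)
Definition jump (Zp Zm : Displacement) : Displacement := {|
  Q1 := fun u v => Q1 Zp u v - Q1 Zm u v;
  T1 := fun k u v => T1 Zp k u v - T1 Zm k u v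
|}.

Definition jump_side (Sp Sm : Side) : Side := {|
  nu := nu Sp;
  lam := lam Sp;
  omega := fun r v => omega Sp r v - omega Sm r v
|}.

Lemma Cn_on_ex_derive (n : nat) (U : R -> R -> Prop) (f : R -> R -> R) (u v : R) :
  Cn_on (S n) U f -> U u v ->
  ex_derive (fun s => f s v) u /\ ex_derive (fun s => f u s) v.
Proof. intros [_ [H _]]; apply H. Qed.

Lemma Cn_on_Derive (n : nat) (U : R -> R -> Prop) (f : R -> R -> R) :
  Cn_on (S n) U f ->
  Cn_on n U (fun x y => Derive (fun s => f s y) x) /\
  Cn_on n U (fun x y => Derive (fun s => f x s) y).
Proof. intros [_ [_ H]]; exact H. Qed.

Lemma Derive_jump_u (n : nat) (f g : R -> R -> R) (u v : R) :
  Cn_on (S n) strip f -> Cn_on (S n) strip g -> strip u v ->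
  Derive (fun s => f s v - g s v) u
  = Derive (fun s => f s v) u - Derive (fun s => g s v) u.
Proof.
intros Hf Hg Hv; apply Derive_minus;
  [apply (Cn_on_ex_derive _ _ _ _ _ Hf Hv) | apply (Cn_on_ex_derive _ _ _ _ _ Hg Hv)].
Qed.

Lemma Derive_jump_v (n : nat) (f g : R -> R -> R) (u v : R) :
  Cn_on (S n) strip f -> Cn_on (S n) strip g -> strip u v ->
  Derive (fun s => f u s - g u s) v
  = Derive (fun s => f u s) v - Derive (fun s => g u s) v.
Proof.
intros Hf Hg Hv; apply Derive_minus;
  [apply (Cn_on_ex_derive _ _ _ _ _ Hf Hv) | apply (Cn_on_ex_derive _ _ _ _ _ Hg Hv)].
Qed.

Section SecondDerivatives.
Variables (f g : R -> R -> R) (u v : R).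
Hypotheses (Hf : Cn_on 2 strip f) (Hg : Cn_on 2 strip g) (Hv : strip u v).

Lemma Derive_jump_uu :
  Derive (fun s => Derive (fun w => f w v - g w v) s) u
  = Derive (fun s => Derive (fun w => f w v) s) u
    - Derive (fun s => Derive (fun w => g w v) s) u.
Proof.
rewrite <- (Derive_jump_u 0 _ _ u v (proj1 (Cn_on_Derive _ _ _ Hf))
  (proj1 (Cn_on_Derive _ _ _ Hg)) Hv).
apply Derive_ext; intros s; now apply (Derive_jump_u 1).
Qed.

Lemma Derive_jump_uv :
  Derive (fun s => Derive (fun w => f s w - g s w) v) u
  = Derive (fun s => Derive (fun w => f s w) v) u
    - Derive (fun s => Derive (fun w => g s w) v) u.
Proof.
rewrite <- (Derive_jump_u 0 _ _ u v (proj2 (Cn_on_Derive _ _ _ Hf))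
  (proj2 (Cn_on_Derive _ _ _ Hg)) Hv).
apply Derive_ext; intros s; now apply (Derive_jump_v 1).
Qed.

Lemma Derive_jump_vu :
  Derive (fun s => Derive (fun w => f w s - g w s) u) v
  = Derive (fun s => Derive (fun w => f w s) u) v
    - Derive (fun s => Derive (fun w => g w s) u) v.
Proof.
rewrite <- (Derive_jump_v 0 _ _ u v (proj1 (Cn_on_Derive _ _ _ Hf))
  (proj1 (Cn_on_Derive _ _ _ Hg)) Hv).
apply Derive_ext_loc; generalize (locally_strip _ _ Hv); apply filter_imp.
intros s Hs; now apply (Derive_jump_u 1).
Qed.

(** The inner derivative splits only for angles in the strip, so the outer theta derivative relies
    on equality near [v]; an outer tau derivative keeps the angle fixed and needs no such
    localisation. *)
Lemma Derive_jump_vv :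
  Derive (fun s => Derive (fun w => f u w - g u w) s) v
  = Derive (fun s => Derive (fun w => f u w) s) v
    - Derive (fun s => Derive (fun w => g u w) s) v.
Proof.
rewrite <- (Derive_jump_v 0 _ _ u v (proj2 (Cn_on_Derive _ _ _ Hf))
  (proj2 (Cn_on_Derive _ _ _ Hg)) Hv).
apply Derive_ext_loc; generalize (locally_strip _ _ Hv); apply filter_imp.
intros s Hs; now apply (Derive_jump_v 1).
Qed.

End SecondDerivatives.

Lemma C2_near_derive (a : R) (f : R -> R) :
  C2_near a f -> locally a (ex_derive f) /\ ex_derive (Derive f) a.
Proof.
intros [d Hd]; split.
- exists d; intros r Hr; apply (Hd r Hr 1%nat); lia.
- refine (proj1 (Hd a _ 2%nat _)); [|lia].
  rewrite Rminus_diag, Rabs_R0; apply cond_pos.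
Qed.

Lemma regular_side_omega (a : R) (S : Side) (v : R) :
  regular_side a S -> 0 < v < PI -> ex_derive (fun r => omega S r v) a.
Proof.
intros [_ [_ [d Hd]]] Hv; refine (proj1 (Cn_on_ex_derive 1 _ _ a v Hd _)).
split; auto.
rewrite Rminus_diag, Rabs_R0; apply cond_pos.
Qed.

(* What is left of the jump of [second_form1_at] after inserting the jump of the
   displacement: the terms where [Q_1^-] multiplies [lambda'] or [nu'']. *)
Definition curvature_jump (a : R) (Sp Sm : Side) (v : R) (i j : hcoord) : R :=
  let l := exp (lam Sp a / 2) in
  let dl := Derive (lam Sp) a - Derive (lam Sm) a in
  let dn := Derive_n (nu Sp) 2 a - Derive_n (nu Sm) 2 a in
  match i, j with
  | h_tau, h_tau =>
      - exp (nu Sp a) / l ^ 2 * (dn / 2 - Derive (nu Sp) a * dl / 4)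
  | h_theta, h_theta => - a * dl / (2 * l ^ 2)
  | h_phi, h_phi => - a * dl * sin v ^ 2 / (2 * l ^ 2)
  | _, _ => 0
  end.

Section Jumps.
Variables (a : R) (Sp Sm : Side) (Zp Zm : Displacement).
Hypotheses (ha : 0 < a) (hSp : regular_side a Sp) (hSm : regular_side a Sm)
  (hback : background_matching a Sp Sm)
  (hZp : regular_displacement Zp) (hZm : regular_displacement Zm).

(** Only nu(a), nu'(a) and lambda(a) enter [h^(1)] from the background, and none of them jumps. *)
Lemma first_form1_at_jump (u v : R) (i j : hcoord) : strip u v ->
  first_form1_at a Sp Zp u v i j - first_form1_at a Sm Zm u v i j
  = first_form1_at a (jump_side Sp Sm) (jump Zp Zm) u v i j.
Proof.
intros Hv; destruct hback as [Hn [Hn' Hl]].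
destruct hZp as [HQp HTp], hZm as [HQm HTm].
unfold first_form1_at; cbn -[pow]; rewrite <- Hn, <- Hn', <- Hl.
pose proof (exp_pos (lam Sp a / 2)) as El.
destruct i, j; rewrite ?(Derive_jump_u 1 (T1 Zp _) (T1 Zm _)),
  ?(Derive_jump_v 1 (T1 Zp _) (T1 Zm _)) by auto; field; lra.
Qed.

(** Now lambda' and nu'' occur as factors of [Q1], and each product is split as [Q^+ F^+ - Q^- F^- =
    [Q] F^+ + Q^- [F]]. *)
Lemma second_form1_at_jump (u v : R) (i j : hcoord) : strip u v ->
  second_form1_at a Sp Zp u v i j - second_form1_at a Sm Zm u v i j
  = second_form1_at a (jump_side Sp Sm) (jump Zp Zm) u v i j
    + Q1 Zm u v * curvature_jump a Sp Sm v i j.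
Proof.
intros Hv; destruct hback as [Hn [Hn' Hl]].
destruct hZp as [HQp HTp], hZm as [HQm HTm].
unfold second_form1_at, curvature_jump; cbn -[pow Derive_n]; rewrite <- Hn, <- Hn', <- Hl.
pose proof (exp_pos (lam Sp a / 2)) as El.
assert (Hw : Derive (fun r => omega Sp r v - omega Sm r v) a
  = Derive (fun r => omega Sp r v) a - Derive (fun r => omega Sm r v) a).
{ apply Derive_minus; apply regular_side_omega; auto. }
rewrite Hw.
destruct i, j;
  rewrite ?(Derive_jump_u 1 (T1 Zp _) (T1 Zm _)),
  ?(Derive_jump_v 1 (T1 Zp _) (T1 Zm _)),
  ?(Derive_jump_v 1 (Q1 Zp) (Q1 Zm)),
  ?(Derive_jump_uu (Q1 Zp) (Q1 Zm)), ?(Derive_jump_vv (Q1 Zp) (Q1 Zm)),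
  ?(Derive_jump_uv (Q1 Zp) (Q1 Zm)), ?(Derive_jump_vu (Q1 Zp) (Q1 Zm))
  by auto; field; lra.
Qed.

Lemma first_order_matching_jump :
  first_order_matching a Sp Sm Zp Zm <->
  forall u v, strip u v -> forall i j,
    first_form1_at a (jump_side Sp Sm) (jump Zp Zm) u v i j = 0 /\
    second_form1_at a (jump_side Sp Sm) (jump Zp Zm) u v i j
      + Q1 Zm u v * curvature_jump a Sp Sm v i j = 0.
Proof.
assert (Hside : forall S, regular_side a S ->
  locally a (fun r => ex_derive (nu S) r /\ ex_derive (lam S) r)
  /\ ex_derive (Derive (nu S)) a).
{ intros S [HSn [HSl _]].
  destruct (C2_near_derive _ _ HSn), (C2_near_derive _ _ HSl); split; auto.
  now apply filter_and. }
destruct (Hside Sp hSp) as [HLp HNp], (Hside Sm hSm) as [HLm HNm].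
destruct (locally_singleton _ _ HLp), (locally_singleton _ _ HLm).
assert (Hforms : forall p i j, 0 < p h_theta < PI ->
  (first_form1 a Sp Zp p i j - first_form1 a Sm Zm p i j
   = first_form1_at a (jump_side Sp Sm) (jump Zp Zm) (p h_tau) (p h_theta) i j) /\
  (second_form1 a Sp Zp p i j - second_form1 a Sm Zm p i j
   = second_form1_at a (jump_side Sp Sm) (jump Zp Zm) (p h_tau) (p h_theta) i j
     + Q1 Zm (p h_tau) (p h_theta)
       * curvature_jump a Sp Sm (p h_theta) i j)).
{ intros p i j Hp.
  pose proof (Rgt_not_eq _ _ (sin_gt_0 _ (proj1 Hp) (proj2 Hp))) as Hs.
  rewrite !first_form1_eq, !second_form1_eq by auto using regular_side_omega.
  split; [now apply first_form1_at_jump | now apply second_form1_at_jump]. }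
split.
- intros HM u v Hv i j.
  (* The forms do not depend on phi, so 0 is an arbitrary choice. *)
  set (p := fun k => match k with h_tau => u | h_theta => v | h_phi => 0 end).
  destruct (Hforms p i j Hv) as [E1 E2], (HM p Hv i j) as [M1 M2].
  cbn [p] in E1, E2; rewrite <- E1, <- E2, M1, M2; split; ring.
- intros HM p Hp i j; destruct (Hforms p i j Hp) as [E1 E2].
  destruct (HM (p h_tau) _ Hp i j) as [M1 M2]; rewrite M1 in E1; rewrite M2 in E2.
  split; apply Rminus_diag_uniq; assumption.
Qed.

End Jumps.

(** * Functions with vanishing derivative, and the reference angles *)

Lemma is_derive_0_eq (f : R -> R) (x y : R) :
  (forall t, Rmin x y <= t <= Rmax x y -> is_derive f t 0) -> f x = f y.
Proof.
intros H; destruct (Rtotal_order x y) as [Hxy | [-> | Hxy]]; [| easy |].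
- apply (eq_is_derive f); [|exact Hxy]; intros t Ht; apply H.
  rewrite Rmin_left, Rmax_right; lra.
- symmetry; apply (eq_is_derive f); [|exact Hxy]; intros t Ht; apply H.
  rewrite Rmin_right, Rmax_left; lra.
Qed.

Lemma strip_PI2 (u : R) : strip u (PI / 2).
Proof. pose proof PI_RGT_0; split; lra. Qed.

(** The angle pi/2 is the base point of every meridian, with [sin] equal to 1 and [cos] to 0; pi/3
    is a second angle with nonzero [cos], used for comparison. *)
Lemma strip_PI3 (u : R) : strip u (PI / 3).
Proof. pose proof PI_RGT_0; split; lra. Qed.

Lemma strip_is_derive_0_eq (f : R -> R) (u v : R) : strip u v ->
  (forall t, strip u t -> is_derive f t 0) -> f v = f (PI / 2).
Proof.
intros Hv H; apply is_derive_0_eq; intros t Ht; apply H.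
pose proof (strip_PI2 u) as H2; unfold strip in *.
destruct Ht; revert H0 H1; unfold Rmin, Rmax.
destruct (Rle_dec v (PI / 2)); lra.
Qed.

Lemma strip_sin_pos (u v : R) : strip u v -> 0 < sin v.
Proof. intros [H1 H2]; now apply sin_gt_0. Qed.

Lemma Derive_eq_0_strip (f : R -> R) (c u v : R) : strip u v ->
  (forall t, strip u t -> f t = c) -> Derive f v = 0.
Proof.
intros Hv H; rewrite (Derive_ext_loc _ (fun _ => c)); [apply Derive_const|].
generalize (locally_strip _ _ Hv); now apply filter_imp.
Qed.

Lemma Derive_eq_0 (f : R -> R) (c u : R) : (forall t, f t = c) -> Derive f u = 0.
Proof. intros H; rewrite (Derive_ext _ (fun _ => c)) by auto; apply Derive_const. Qed.

(** * Solution of the jump equations, beginning with sufficiency *)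

Section Solution.
Variables (a : R) (Sp Sm : Side) (Zp Zm : Displacement).
Hypotheses (ha : 0 < a) (hSp : regular_side a Sp) (hSm : regular_side a Sm)
  (hback : background_matching a Sp Sm)
  (hZp : regular_displacement Zp) (hZm : regular_displacement Zm).

Let W (k : hcoord) (u v : R) : R := T1 Zp k u v - T1 Zm k u v.
Let q (u v : R) : R := Q1 Zp u v - Q1 Zm u v.
Let l : R := exp (lam Sp a / 2).
Let N : R := Derive (nu Sp) a.
Let dl : R := Derive (lam Sp) a - Derive (lam Sm) a.
Let dn : R := Derive_n (nu Sp) 2 a - Derive_n (nu Sm) 2 a.

Lemma jump_is_derive_u (k : hcoord) (u v : R) : strip u v ->
  is_derive (fun s => W k s v) u (Derive (fun s => W k s v) u).
Proof.
intros Hv; apply Derive_correct.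
apply (ex_derive_minus (fun s => T1 Zp k s v) (fun s => T1 Zm k s v));
  [exact (proj1 (Cn_on_ex_derive 1 strip _ u v (proj2 hZp k) Hv))
  |exact (proj1 (Cn_on_ex_derive 1 strip _ u v (proj2 hZm k) Hv))].
Qed.

Lemma jump_is_derive_v (k : hcoord) (u v : R) : strip u v ->
  is_derive (fun s => W k u s) v (Derive (fun s => W k u s) v).
Proof.
intros Hv; apply Derive_correct.
apply (ex_derive_minus (fun s => T1 Zp k u s) (fun s => T1 Zm k u s));
  [exact (proj2 (Cn_on_ex_derive 1 strip _ u v (proj2 hZp k) Hv))
  |exact (proj2 (Cn_on_ex_derive 1 strip _ u v (proj2 hZm k) Hv))].
Qed.

(** The constants [ctau] and [cphi] are translations along the Killing fields of tau and phi, which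
    leave both background forms unchanged; the term [b * u] compensates the jump of [omega]. *)
Lemma matching_of_jump (b ctau cphi : R) :
  (forall th, 0 < th < PI ->
     omega Sp a th - omega Sm a th = b /\
     Derive (fun r => omega Sp r th) a - Derive (fun r => omega Sm r th) a = 0) ->
  (forall u v, strip u v ->
     W h_tau u v = ctau /\ W h_theta u v = 0 /\ W h_phi u v = b * u + cphi) ->
  (forall u v, strip u v ->
     q u v = 0 /\ Q1 Zp u v * dl = 0 /\ Q1 Zp u v * dn = 0) ->
  first_order_matching a Sp Sm Zp Zm.
Proof.
intros Hw HW Hq; apply first_order_matching_jump; auto.
intros u v Hv.
assert (Wt : W h_theta u v = 0) by (apply HW; auto).
assert (Wut : Derive (fun s => W h_tau s v) u = 0).
{ apply Derive_eq_0 with ctau; intros t; apply (HW t v Hv). }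
assert (Wuth : Derive (fun s => W h_theta s v) u = 0).
{ apply Derive_eq_0 with 0; intros t; apply (HW t v Hv). }
assert (Wup : Derive (fun s => W h_phi s v) u = b).
{ rewrite (Derive_ext _ (fun s => b * s + cphi)) by (intros t; apply (HW t v Hv)).
  apply is_derive_unique; auto_derive; auto; ring. }
assert (Wvt : Derive (fun s => W h_tau u s) v = 0).
{ apply Derive_eq_0_strip with ctau u; auto; intros t Ht; apply (HW u t Ht). }
assert (Wvth : Derive (fun s => W h_theta u s) v = 0).
{ apply Derive_eq_0_strip with 0 u; auto; intros t Ht; apply (HW u t Ht). }
assert (Wvp : Derive (fun s => W h_phi u s) v = 0).
{ apply Derive_eq_0_strip with (b * u + cphi) u; auto.
  intros t Ht; apply (HW u t Ht). }
assert (q0 : q u v = 0) by (apply Hq; auto).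
assert (qu : forall t, Derive (fun s => q s v) t = 0).
{ intros t; apply Derive_eq_0 with 0; intros s; apply (Hq s v Hv). }
assert (qv : forall x t, strip x t -> Derive (fun s => q x s) t = 0).
{ intros x t Ht; apply Derive_eq_0_strip with 0 x; auto; intros s Hs.
  apply (Hq x s Hs). }
assert (quu : Derive (fun s => Derive (fun w => q w v) s) u = 0).
{ now apply Derive_eq_0 with 0. }
assert (quv : Derive (fun s => Derive (fun w => q s w) v) u = 0).
{ apply Derive_eq_0 with 0; intros t; now apply qv. }
assert (qvu : Derive (fun s => Derive (fun w => q w s) u) v = 0).
{ apply Derive_eq_0_strip with 0 u; auto; intros t Ht.
  apply Derive_eq_0 with 0; intros s; apply (Hq s t Ht). }
assert (qvv : Derive (fun s => Derive (fun w => q u w) s) v = 0).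
{ apply Derive_eq_0_strip with 0 u; auto. }
assert (Hqv := qv u v Hv).
destruct (Hq u v Hv) as [_ [Hl Hn]], (Hw v Hv) as [Hw0 Hw1].
assert (Qm : Q1 Zm u v = Q1 Zp u v) by (unfold q in q0; lra).
assert (Hw1' : Derive (fun r => omega Sp r v - omega Sm r v) a = 0).
{ rewrite <- Hw1; apply Derive_minus; apply regular_side_omega; auto. }
(* Either [Q1 Zp u v] is zero or both [dl] and [dn] are, and every entry of [curvature_jump] is
   linear in these two. *)
assert (HC : forall i j, Q1 Zp u v * curvature_jump a Sp Sm v i j = 0).
{ intros i j; pose proof (exp_pos (lam Sp a / 2)) as El.
  unfold curvature_jump; fold dl dn.
  destruct (Rmult_integral _ _ Hl) as [-> | ->]; [ring|].
  destruct (Rmult_integral _ _ Hn) as [-> | ->]; [ring|].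
  destruct i, j; field; lra. }
rewrite Qm.
unfold W, q in *.
pose proof (exp_pos (lam Sp a / 2)) as El.
intros i j; split; [|rewrite HC]; unfold first_form1_at, second_form1_at;
  cbn -[pow Derive_n];
  destruct i, j; rewrite ?Wut, ?Wuth, ?Wup, ?Wvt, ?Wvth, ?Wvp, ?quu, ?quv, ?qvu,
  ?qvv, ?Hqv, ?q0, ?Wt, ?Hw0, ?Hw1'; field; lra.
Qed.

(** * Consequences of the matching conditions *)

Section Necessity.
Hypothesis hm : first_order_matching a Sp Sm Zp Zm.

Lemma l_pos : 0 < l.
Proof. apply exp_pos. Qed.

(** The conjuncts are the components (tau,tau), (tau,theta), (tau,phi), (theta,theta), (theta,phi),
    (phi,phi), freed of factors that are nonzero because [sin v] is positive on the strip. *)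
Lemma first_form1_equations (u v : R) : strip u v ->
  2 * Derive (fun s => W h_tau s v) u = N * (q u v / l) /\
  exp (nu Sp a) * Derive (fun s => W h_tau u s) v
    = a ^ 2 * Derive (fun s => W h_theta s v) u /\
  Derive (fun s => W h_phi s v) u = omega Sp a v - omega Sm a v /\
  a * Derive (fun s => W h_theta u s) v = q u v / l /\
  Derive (fun s => W h_phi u s) v = 0 /\
  a * cos v * W h_theta u v = sin v * (q u v / l).
Proof.
intros Hv.
pose proof (proj1 (first_order_matching_jump a Sp Sm Zp Zm ha hSp hSm hback hZp hZm)
  hm u v Hv) as HM.
pose proof (strip_sin_pos u v Hv) as Hs.
pose proof (exp_pos (nu Sp a)) as En.
assert (Hs2 : a ^ 2 * sin v ^ 2 <> 0).
{ apply Rmult_integral_contrapositive; split; apply pow_nonzero; lra. }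
pose proof (proj1 (HM h_tau h_tau)) as E1.
pose proof (proj1 (HM h_tau h_theta)) as E2.
pose proof (proj1 (HM h_tau h_phi)) as E3.
pose proof (proj1 (HM h_theta h_theta)) as E4.
pose proof (proj1 (HM h_theta h_phi)) as E5.
pose proof (proj1 (HM h_phi h_phi)) as E6.
unfold first_form1_at in *; cbn -[pow Derive_n] in *.
fold (q u v) l N in E1, E4, E6.
unfold W; repeat split.
- apply (Rmult_eq_reg_l (- exp (nu Sp a))); lra.
- lra.
- apply (Rmult_eq_reg_l (a ^ 2 * sin v ^ 2)); auto; lra.
- apply (Rmult_eq_reg_l (2 * a)); lra.
- apply (Rmult_eq_reg_l (a ^ 2 * sin v ^ 2)); auto; lra.
- apply (Rmult_eq_reg_l (2 * a * sin v)); [lra|].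
  apply Rgt_not_eq, Rmult_lt_0_compat; lra.
Qed.

(** These are the (tau,tau), (tau,theta), (tau,phi) and (phi,phi) components, with the terms in
    lambda' and nu'' regrouped by side. The equations of [h^(1)] eliminate the theta derivative of
    [W h_tau] from the second and cancel [[omega]] against the tau derivative of [W h_phi] in the
    third. *)
Lemma second_form1_equations (u v : R) : strip u v ->
  N * exp (nu Sp a) / l * Derive (fun s => W h_tau s v) u
  - Derive (fun s => Derive (fun w => q w v) s) u
  - exp (nu Sp a) / l ^ 2 * (N ^ 2 / 2 * q u v
      + (Q1 Zp u v * Derive_n (nu Sp) 2 a - Q1 Zm u v * Derive_n (nu Sm) 2 a) / 2
      - N / 4
        * (Q1 Zp u v * Derive (lam Sp) a - Q1 Zm u v * Derive (lam Sm) a)) = 0 /\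
  (N * a / 2 - 1) * (a / l) * Derive (fun s => W h_theta s v) u
    = Derive (fun s => Derive (fun w => q s w) v) u /\
  Derive (fun r => omega Sp r v) a - Derive (fun r => omega Sm r v) a = 0 /\
  - 2 * a * cos v / l * W h_theta u v - cos v * Derive (fun s => q u s) v
  + sin v / l ^ 2 * (q u v - a / 2
     * (Q1 Zp u v * Derive (lam Sp) a - Q1 Zm u v * Derive (lam Sm) a)) = 0.
Proof.
intros Hv.
destruct (first_form1_equations u v Hv) as [_ [F2 [F3 _]]].
pose proof (proj1 (first_order_matching_jump a Sp Sm Zp Zm ha hSp hSm hback hZp hZm)
  hm u v Hv) as HM.
pose proof (strip_sin_pos u v Hv) as Hs.
pose proof l_pos as Hl.
pose proof (proj2 (HM h_tau h_tau)) as E1.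
pose proof (proj2 (HM h_tau h_theta)) as E2.
pose proof (proj2 (HM h_tau h_phi)) as E3.
pose proof (proj2 (HM h_phi h_phi)) as E6.
assert (Hw : Derive (fun r => omega Sp r v - omega Sm r v) a
  = Derive (fun r => omega Sp r v) a - Derive (fun r => omega Sm r v) a).
{ apply Derive_minus; apply regular_side_omega; auto. }
unfold second_form1_at, curvature_jump in *; cbn -[pow Derive_n] in *.
fold l N in E1, E2, E3, E6.
unfold W, q in *; repeat split.
- rewrite <- E1; field; lra.
- apply Rminus_diag_uniq.
  transitivity (N / (2 * l) * (a ^ 2 * Derive
      (fun s => T1 Zp h_theta s v - T1 Zm h_theta s v) u)
    - a / l * Derive (fun s => T1 Zp h_theta s v - T1 Zm h_theta s v) u
    - Derive (fun s => Derive (fun w => Q1 Zp s w - Q1 Zm s w) v) u);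
    [field; lra|].
  rewrite <- F2, <- E2; field; lra.
- rewrite <- Hw; apply (Rmult_eq_reg_l (sin v ^ 2 * a / l * (a / 2))).
  + rewrite F3 in E3; rewrite Rmult_0_r, <- E3; field; lra.
  + pose proof (pow_lt _ 2 Hs); pose proof (Rinv_0_lt_compat _ Hl).
    apply Rgt_not_eq; unfold Rdiv; repeat apply Rmult_lt_0_compat; lra.
- apply (Rmult_eq_reg_l (sin v)); [|lra].
  rewrite Rmult_0_r, <- E6; field; lra.
Qed.

(** At the equator [sin] is 1, so this value is the coefficient of [sin v] in [W h_theta]. *)
Let alpha (u : R) : R := W h_theta u (PI / 2).

(* By the angular components [W h_theta / sin] is constant along the meridian:
   the jump is a multiple of the conformal Killing vector [sin d_theta]. *)
Lemma jump_theta (u v : R) : strip u v ->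
  W h_theta u v = alpha u * sin v /\ q u v = a * l * alpha u * cos v.
Proof.
pose proof l_pos as Hl.
assert (HW : forall t, strip u t -> W h_theta u t = alpha u * sin t).
{ intros t Ht; pose proof (strip_sin_pos u t Ht) as Hs.
  enough (H : W h_theta u t / sin t = W h_theta u (PI / 2) / sin (PI / 2)).
  { rewrite sin_PI2, Rdiv_1_r in H; unfold alpha; rewrite <- H; field; lra. }
  apply (strip_is_derive_0_eq (fun w => W h_theta u w / sin w) u t Ht).
  intros w Hw; pose proof (strip_sin_pos u w Hw) as Hsw.
  pose proof (jump_is_derive_v h_theta u w Hw) as HD.
  destruct (first_form1_equations u w Hw) as [_ [_ [_ [F4 [_ F6]]]]].
  evar_last; [apply is_derive_div;
    [exact HD | apply is_derive_sin | lra]|].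
  (* The numerator of the quotient rule, times [a], is [sin w] times the left side of the
     (theta,theta) equation minus that of the (phi,phi) equation. *)
  cbn; apply (Rmult_eq_reg_l (a * sin w ^ 2)).
  - transitivity (sin w * (a * Derive (fun s => W h_theta u s) w)
      - a * cos w * W h_theta u w); [field; lra|].
    rewrite F4, F6; ring.
  - pose proof (pow_lt _ 2 Hsw); apply Rgt_not_eq, Rmult_lt_0_compat; lra. }
intros Hv; split; [now apply HW|].
pose proof (strip_sin_pos u v Hv) as Hs.
destruct (first_form1_equations u v Hv) as [_ [_ [_ [_ [_ F6]]]]].
rewrite HW in F6 by auto; apply (Rmult_eq_reg_l (sin v / l)).
- transitivity (sin v * (q u v / l)); [field; lra|].
  rewrite <- F6; field; lra.
- apply Rgt_not_eq, Rdiv_lt_0_compat; lra.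
Qed.

Lemma Derive_q_v (u v : R) : strip u v ->
  Derive (fun s => q u s) v = - (a * l * sin v) * alpha u.
Proof.
intros Hv; rewrite (Derive_ext_loc _ (fun s => a * l * alpha u * cos s)).
- apply is_derive_unique; auto_derive; auto; ring.
- generalize (locally_strip _ _ Hv); apply filter_imp.
  intros s Hs; now apply jump_theta.
Qed.

Lemma jump_phi (u v : R) : strip u v -> W h_phi u v = W h_phi u (PI / 2).
Proof.
intros Hv; apply (strip_is_derive_0_eq (fun s => W h_phi u s) u v Hv).
intros t Ht; destruct (first_form1_equations u t Ht) as [_ [_ [_ [_ [F5 _]]]]].
rewrite <- F5; now apply jump_is_derive_v.
Qed.

(** The jump of [omega] equals the tau derivative of [W h_phi], which does not depend on the angle;
    tau = 0 is an arbitrary choice. *)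
Lemma omega_jump : forall th, 0 < th < PI ->
  omega Sp a th - omega Sm a th
    = omega Sp a (PI / 2) - omega Sm a (PI / 2) /\
  Derive (fun r => omega Sp r th) a - Derive (fun r => omega Sm r th) a = 0.
Proof.
intros v Hv; split; [|now apply (second_form1_equations 0)].
destruct (first_form1_equations 0 v Hv) as [_ [_ [<- _]]].
destruct (first_form1_equations 0 (PI / 2) (strip_PI2 0)) as [_ [_ [<- _]]].
apply Derive_ext; intros s; now apply jump_phi.
Qed.

Hypothesis hnd : 2 * exp (lam Sp a) - 2 + a * N <> 0.

(** At the equator the (tau,theta) component of [kappa^(1)] becomes [a / (2 l) * (2 l^2 - 2 + a N) *
    alpha' = 0], and [l^2 = e^lambda] turns the bracket into the quantity assumed nonzero. *)
Lemma Derive_alpha (u : R) : Derive alpha u = 0.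
Proof.
pose proof l_pos as Hl; pose proof (strip_PI2 u) as H2.
destruct (second_form1_equations u _ H2) as [_ [E2 _]].
rewrite (Derive_ext (fun s => Derive (fun w => q s w) (PI / 2))
  (fun s => - (a * l * sin (PI / 2)) * alpha s)), Derive_scal, sin_PI2 in E2
  by (intros s; apply Derive_q_v, strip_PI2).
change (fun s => W h_theta s (PI / 2)) with alpha in E2.
destruct (Rmult_integral (2 * exp (lam Sp a) - 2 + a * N) (Derive alpha u))
  as [H | H]; [|tauto|exact H].
rewrite exp_half; fold l.
apply (Rmult_eq_reg_l (a / (2 * l))).
- rewrite Rmult_0_r; apply Rminus_diag_eq in E2; rewrite <- E2; field; lra.
- apply Rgt_not_eq, Rdiv_lt_0_compat; lra.
Qed.

Lemma jump_tau_v (u v : R) : strip u v -> W h_tau u v = W h_tau u (PI / 2).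
Proof.
intros Hv; apply (strip_is_derive_0_eq (fun s => W h_tau u s) u v Hv).
intros t Ht; destruct (first_form1_equations u t Ht) as [_ [F2 _]].
replace 0 with (Derive (fun s => W h_tau u s) t);
  [now apply jump_is_derive_v|].
rewrite (Derive_ext (fun s => W h_theta s t) (fun s => sin t * alpha s)),
  Derive_scal, Derive_alpha in F2
  by (intros s; rewrite Rmult_comm; now apply jump_theta).
apply (Rmult_eq_reg_l (exp (nu Sp a))); [lra|].
apply Rgt_not_eq, exp_pos.
Qed.

(** The tau derivative of [W h_tau] is the same at all angles, whereas the (tau,tau) component of
    [h^(1)] makes it proportional to [N * alpha u * cos v]; comparing pi/2 with pi/3 forces the
    coefficient to vanish. *)
Lemma N_alpha (u : R) : N * alpha u = 0.
Proof.
pose proof l_pos as Hl.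
destruct (first_form1_equations u _ (strip_PI2 u)) as [F2 _].
destruct (first_form1_equations u _ (strip_PI3 u)) as [F3 _].
rewrite (Derive_ext (fun s => W h_tau s (PI / 3))
  (fun s => W h_tau s (PI / 2))), F2 in F3
  by (intros s; apply jump_tau_v, strip_PI3).
rewrite (proj2 (jump_theta u _ (strip_PI2 u))),
  (proj2 (jump_theta u _ (strip_PI3 u))), cos_PI2, cos_PI3 in F3.
apply (Rmult_eq_reg_l (a / 2)); [|lra].
rewrite Rmult_0_r; transitivity (N * (a * l * alpha u * (1 / 2) / l));
  [field; lra|].
rewrite <- F3; field; lra.
Qed.

Hypothesis hnt : ~ translation_degenerate a Sp Sm.

(** A nonzero value makes [q] nonzero at pi/3. Dividing the (phi,phi) and (tau,tau) components of
    [kappa^(1)] there by [q] then gives the two relations of [translation_degenerate]. *)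
Lemma alpha_0 (u : R) : alpha u = 0.
Proof.
pose proof l_pos as Hl; pose proof (strip_PI3 u) as H3.
destruct (Req_dec (alpha u) 0) as [|Ha]; [easy | exfalso; apply hnt].
assert (HN : N = 0).
{ destruct (Rmult_integral _ _ (N_alpha u)); [easy | contradiction]. }
destruct (second_form1_equations u _ H3) as [E1 [_ [_ E4]]].
rewrite (Derive_q_v u _ H3), (proj1 (jump_theta u _ H3)), cos_PI3 in E4.
rewrite (Derive_ext (fun s => Derive (fun w => q w (PI / 3)) s) (fun _ => 0)),
  Derive_const, HN in E1.
2: { intros s; rewrite (Derive_ext _ (fun t => a * l * cos (PI / 3) * alpha t)).
  - rewrite Derive_scal, Derive_alpha; ring.
  - intros t; rewrite (proj2 (jump_theta t _ (strip_PI3 t))); ring. }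
pose proof (proj2 (jump_theta u _ H3)) as Hq; rewrite cos_PI3 in Hq.
assert (Hq0 : q u (PI / 3) <> 0).
{ rewrite Hq; repeat apply Rmult_integral_contrapositive_currified; lra. }
assert (Hp : Q1 Zp u (PI / 3) = q u (PI / 3) + Q1 Zm u (PI / 3)) by (unfold q; ring).
rewrite Hp in E1, E4.
pose proof (strip_sin_pos u _ H3) as Hs.
split; [exact HN|].
(* This is [Q_1^- / [Q_1]], taken at pi/3 because [q] vanishes at the equator. *)
exists (Q1 Zm u (PI / 3) / q u (PI / 3)); split.
- apply (Rmult_eq_reg_l (q u (PI / 3) * (- a / 2) * (sin (PI / 3) / l ^ 2))).
  + apply Rminus_diag_uniq; rewrite exp_half; fold l; rewrite <- E4.
    rewrite Hq in *; field; lra.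
  + repeat apply Rmult_integral_contrapositive_currified; try lra.
    pose proof (pow_lt _ 2 Hl); apply Rinv_neq_0_compat; lra.
- apply (Rmult_eq_reg_l (q u (PI / 3) / 2 * (- exp (nu Sp a) / l ^ 2))).
  + rewrite Rmult_0_r, <- E1; field; lra.
  + pose proof (exp_pos (nu Sp a)); pose proof (pow_lt _ 2 Hl).
    repeat apply Rmult_integral_contrapositive_currified; try lra.
    apply Rinv_neq_0_compat; lra.
Qed.

(** Once [alpha] vanishes, so do [q] and [W h_theta]. The (phi,phi) component of [kappa^(1)] then
    yields the condition on [dl], which has to come first because [dl] also occurs, multiplied by
    [N], in the (tau,tau) component that yields the one on [dn]. *)
Lemma jump_of_matching (b : R) :
  (forall th, 0 < th < PI -> omega Sp a th - omega Sm a th = b) ->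
  (forall u v, strip u v ->
     W h_tau u v = W h_tau 0 (PI / 2) /\ W h_theta u v = 0 /\
     W h_phi u v = b * u + W h_phi 0 (PI / 2)) /\
  (forall u v, strip u v -> q u v = 0 /\ Q1 Zp u v * dl = 0 /\ Q1 Zp u v * dn = 0).
Proof.
intros Hb; pose proof l_pos as Hl; pose proof (exp_pos (nu Sp a)) as En.
assert (Hq : forall u v, strip u v -> q u v = 0).
{ intros u v Hv; rewrite (proj2 (jump_theta u v Hv)), alpha_0; ring. }
assert (Hth : forall u v, strip u v -> W h_theta u v = 0).
{ intros u v Hv; rewrite (proj1 (jump_theta u v Hv)), alpha_0; ring. }
assert (Ht : forall u v, strip u v -> Derive (fun s => W h_tau s v) u = 0).
{ intros u v Hv; destruct (first_form1_equations u v Hv) as [F1 _].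
  rewrite Hq in F1 by auto; unfold Rdiv in F1; lra. }
split; intros u v Hv.
- split; [|split; [now apply Hth|]].
  + rewrite jump_tau_v by auto.
    apply (is_derive_0_eq (fun s => W h_tau s (PI / 2))); intros t _.
    rewrite <- (Ht t _ (strip_PI2 t)); apply jump_is_derive_u, (strip_PI2 t).
  + rewrite jump_phi by auto.
    enough (W h_phi u (PI / 2) - b * u = W h_phi 0 (PI / 2) - b * 0) by lra.
    apply (is_derive_0_eq (fun s => W h_phi s (PI / 2) - b * s)); intros t _.
    destruct (first_form1_equations t _ (strip_PI2 t)) as [_ [_ [F3 _]]].
    rewrite Hb in F3 by apply (strip_PI2 0).
    evar_last; [apply @is_derive_minus;
      [apply jump_is_derive_u, (strip_PI2 t) | apply is_derive_scal, is_derive_id]|].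
    rewrite F3; cbn; unfold minus, plus, opp, one; cbn; ring.
- split; [now apply Hq|].
  destruct (second_form1_equations u v Hv) as [E1 [_ [_ E4]]].
  rewrite Derive_q_v, alpha_0, Hth, Hq in E4 by auto.
  rewrite Ht, Hq in E1 by auto.
  rewrite (Derive_ext (fun s => Derive (fun w => q w v) s) (fun _ => 0)),
    Derive_const in E1
    by (intros s; apply Derive_eq_0 with 0; intros t; now apply Hq).
  assert (Qm : Q1 Zm u v = Q1 Zp u v) by (specialize (Hq u v Hv); unfold q in Hq; lra).
  rewrite Qm in E1, E4; pose proof (strip_sin_pos u v Hv) as Hs.
  pose proof (pow_lt _ 2 Hl) as Hl2.
  assert (Hdl : Q1 Zp u v * dl = 0).
  { apply (Rmult_eq_reg_l (- a / 2 * (sin v / l ^ 2))).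
    - rewrite Rmult_0_r, <- E4; unfold dl; field; lra.
    - repeat apply Rmult_integral_contrapositive_currified; try lra.
      apply Rinv_neq_0_compat; lra. }
  split; [exact Hdl|].
  apply (Rmult_eq_reg_l (- exp (nu Sp a) / l ^ 2 / 2)).
  + rewrite Rmult_0_r, <- E1.
    transitivity (- exp (nu Sp a) / l ^ 2 * (Q1 Zp u v * dn / 2
      - N / 4 * (Q1 Zp u v * dl))); [rewrite Hdl; field; lra|].
    unfold dl, dn; field; lra.
  + repeat apply Rmult_integral_contrapositive_currified; try lra.
    apply Rinv_neq_0_compat; lra.
Qed.

End Necessity.

End Solution.

(** * Explicit regular displacements and the final equivalences *)

Lemma Cn_on_linear (n : nat) (U : R -> R -> Prop) (c d : R) :
  Cn_on n U (fun u _ => c * u + d).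
Proof.
assert (Hc : forall c d x y, continuity_2d_pt (fun u _ => c * u + d) x y).
{ clear; intros c d x y.
  apply continuity_2d_pt_plus; [|apply continuity_2d_pt_const].
  apply continuity_2d_pt_mult;
    [apply continuity_2d_pt_const | apply continuity_2d_pt_id1]. }
(* The partial derivatives of an affine function are affine with other coefficients, so [c] and [d]
   vary in the induction. *)
revert c d; induction n as [|n IH]; intros c d; [now split|].
assert (D1 : (fun x y : R => Derive (fun s => c * s + d) x) = (fun x y => 0 * x + c)).
{ extensionality x; extensionality y.
  apply is_derive_unique; auto_derive; auto; ring. }
assert (D2 : (fun x y : R => Derive (fun _ => c * x + d) y) = (fun x y => 0 * x + 0)).
{ extensionality x; extensionality y; rewrite Derive_const; ring. }
split; [auto | split; [|split]].
- intros x y _; split; auto_derive; auto.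
- rewrite D1; apply IH.
- rewrite D2; apply IH.
Qed.

Lemma regular_displacement_linear (b : R) :
  regular_displacement {|
    Q1 := fun _ _ => 0;
    T1 := fun k u _ => match k with h_phi => b * u | _ => 0 end |}.
Proof.
assert (H0 : forall c, (fun u _ : R => c * u) = (fun u _ => c * u + 0)).
{ intros c; extensionality u; extensionality v; ring. }
assert (H1 : (fun _ _ : R => 0) = (fun u _ => 0 * u + 0)).
{ extensionality u; extensionality v; ring. }
split; [|intros []]; cbn -[Cn_on]; rewrite ?H1, ?H0; apply Cn_on_linear.
Qed.

Theorem proposition1
  (a : R) (ha : 0 < a) (Sp Sm : Side)
  (hSp : regular_side a Sp) (hSm : regular_side a Sm)
  (hback : background_matching a Sp Sm) :
  (fulfil_first_order_matching a Sp Sm <->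
   exists b1 : R, forall th : R, 0 < th < PI ->
     omega Sp a th - omega Sm a th = b1 /\
     Derive (fun r => omega Sp r th) a - Derive (fun r => omega Sm r th) a = 0)
  /\
  (2 * exp (lam Sp a) - 2 + a * Derive (nu Sp) a <> 0 ->
   ~ translation_degenerate a Sp Sm ->
   forall b1 : R,
   (forall th : R, 0 < th < PI ->
      omega Sp a th - omega Sm a th = b1 /\
      Derive (fun r => omega Sp r th) a - Derive (fun r => omega Sm r th) a = 0) ->
   forall Zp Zm : Displacement,
   regular_displacement Zp -> regular_displacement Zm ->
   (first_order_matching a Sp Sm Zp Zm <->
    (exists ctau cphi : R, forall tau th : R, 0 < th < PI ->
       T1 Zp h_tau tau th - T1 Zm h_tau tau th = ctau /\
       T1 Zp h_theta tau th - T1 Zm h_theta tau th = 0 /\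
       T1 Zp h_phi tau th - T1 Zm h_phi tau th = b1 * tau + cphi) /\
    (forall tau th : R, 0 < th < PI ->
       Q1 Zp tau th - Q1 Zm tau th = 0 /\
       Q1 Zp tau th * (Derive (lam Sp) a - Derive (lam Sm) a) = 0 /\
       Q1 Zp tau th * (Derive_n (nu Sp) 2 a - Derive_n (nu Sm) 2 a) = 0))).
Proof.
split; [split|].
- intros [Zp [Zm [hZp [hZm hm]]]].
  exists (omega Sp a (PI / 2) - omega Sm a (PI / 2)).
  exact (omega_jump a Sp Sm Zp Zm ha hSp hSm hback hZp hZm hm).
- intros [b Hb].
  (* The simplest displacements with the required jump: all of [b * u] sits on the interior side,
     and zero [Q1] makes the conditions on lambda' and nu'' trivial. *)
  exists {| Q1 := fun _ _ => 0;
    T1 := fun k u _ => match k with h_phi => b * u | _ => 0 end |}.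
  (* Zero is written [0 * u] to be an instance of [regular_displacement_linear]. *)
  exists {| Q1 := fun _ _ => 0;
    T1 := fun k u _ => match k with h_phi => 0 * u | _ => 0 end |}.
  split; [|split]; try apply regular_displacement_linear.
  apply (matching_of_jump a Sp Sm _ _) with b 0 0; auto;
    try apply regular_displacement_linear;
    intros u v _; cbn; repeat split; ring.
- intros hnd hnt b Hb Zp Zm hZp hZm; split.
  + intros hm.
    destruct (jump_of_matching a Sp Sm Zp Zm ha hSp hSm hback hZp hZm hm hnd hnt b)
      as [HW Hq]; [intros th Hth; now apply Hb|].
    split; [|exact Hq].
    do 2 eexists; exact HW.
  + intros [[ctau [cphi HW]] Hq].
    exact (matching_of_jump a Sp Sm Zp Zm ha hSp hSm hback hZp hZm b ctau cphi
      Hb HW Hq).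
Qed.
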